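(* For $a,b\in(0,\infty)$ the following hold. (1) $$\mathcal{M}(\Gamma_{2ab/(a+b)})\leq\sqrt{\mathcal{M}(\Gamma_a)\mathcal{M}(\Gamma_b)}\leq\frac{\mathcal{M}(\Gamma_a)+\mathcal{M}(\Gamma_b)}{2}\leq\mathcal{M}(\Gamma_{(a+b)/2}).$$ (2) For real $p$, $$\mathcal{M}(\Gamma_{H_p(a,b)})\leq H_p(\mathcal{M}(\Gamma_a),\mathcal{M}(\Gamma_b))\quad\text{if } p\leq-1,$$ $$\mathcal{M}(\Gamma_{H_p(a,b)})\geq H_p(\mathcal{M}(\Gamma_a),\mathcal{M}(\Gamma_b))\quad\text{if } p\geq1.$$ Equality holds in each case (i.e. in each of these inequalities) if and only if $a=b$.
   Context: For $b>0$ let $R=[0,1]\times[0,b]$ and let $\Gamma_b$ be the family of curves joining the two opposite sides of length $b$ of the rectangle $R$ in the exterior of $R$; $\mathcal{M}(\Gamma_b)$ denotes the (conformal) modulus of this curve family. For $0<r<1$ let $\mathcal{K}(r)=\int_0^{\pi/2}\frac{dt}{\sqrt{1-r^2\sin^2t}}$ and $\mathcal{E}(r)=\int_0^{\pi/2}\sqrt{1-r^2\sin^2t}\,dt$ be the complete elliptic integrals, $r'=\sqrt{1-r^2}$, $\mathcal{K}'(r)=\mathcal{K}(r')$, $\mathcal{E}'(r)=\mathcal{E}(r')$ (not derivatives). Let $\psi:(0,1)\to(0,\infty)$, $\psi(r)=\frac{2(\mathcal{E}(r)-(1-r)\mathcal{K}(r))}{\mathcal{E}'(r)-r\mathcal{K}'(r)}$,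 which is an increasing homeomorphism onto $(0,\infty)$, and $\mu(r)=\frac{\pi}{2}\frac{\mathcal{K}'(r)}{\mathcal{K}(r)}$ for $r\in(0,1)$. By the known formula of Duren and Pfaltzgraff, which is the expression for the modulus used throughout, $$\mathcal{M}(\Gamma_b)=\frac{1}{\pi}\mu(\psi^{-1}(1/b)).$$ For $x,y>0$ the power mean is $H_p(x,y)=\left(\frac{x^p+y^p}{2}\right)^{1/p}$ if $p\neq0$, and $H_0(x,y)=\sqrt{xy}$. *)

(* Defs.v *)
From Stdlib Require Import Reals ClassicalEpsilon.
From Coquelicot Require Import Coquelicot.
Open Scope R_scope.

Definition ellK (r : R) : R :=
  RInt (fun t => 1 / sqrt (1 - r ^ 2 * sin t ^ 2)) 0 (PI / 2).

Definition ellE (r : R) : R :=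
  RInt (fun t => sqrt (1 - r ^ 2 * sin t ^ 2)) 0 (PI / 2).

Definition compl_modulus (r : R) : R := sqrt (1 - r ^ 2).

(* The "primed" integrals are values at the complementary modulus, not
   derivatives. *)
Definition ellK' (r : R) : R := ellK (compl_modulus r).
Definition ellE' (r : R) : R := ellE (compl_modulus r).

Definition mu (r : R) : R := PI / 2 * (ellK' r / ellK r).

Definition psi (r : R) : R :=
  2 * (ellE r - (1 - r) * ellK r) / (ellE' r - r * ellK' r).

(* psi is an increasing homeomorphism of (0,1) onto (0,oo), so for y > 0 the
   chosen point exists and is unique; for y <= 0 the value is unspecified. *)
Definition psi_inv (y : R) : R :=
  epsilon (inhabits 0) (fun r => 0 < r < 1 /\ psi r = y).

(* M(Gamma_b), the conformal modulus of the family of curves joining the two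
   sides of length b of [0,1] x [0,b] in the exterior of the rectangle, for
   b > 0, given by the formula of Duren and Pfaltzgraff. *)
Definition modulus_Gamma (b : R) : R := 1 / PI * mu (psi_inv (1 / b)).

(* Meant for x, y > 0, where Rpower is the usual real power. *)
Definition power_mean (p x y : R) : R :=
  if Req_EM_T p 0 then sqrt (x * y)
  else Rpower ((Rpower x p + Rpower y p) / 2) (1 / p).

(* Main.v *)
(* Parametrize by r, with b = 1 / psi r and M = K' / (2 K).  Legendre's combination
   E K' + E' K - K K' occurs in the derivatives of both psi and K' / K and cancels in
     dM/db = (E - (1-r) K)^2 / (r (1-r)^2 K^2),
     d(1/M)/d(1/b) = (E' - r K')^2 / (r (1-r)^2 K'^2).
   With c = E/K - (1-r) the first slope has logarithmic derivative of the sign of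
   (2r - c)(2c + (1-r)^2), hence increases with r; with c = E'/K' - r the second one has
   that of (2c - (1-r)^2)(c + 2r), hence decreases.  So M as a function of b, and 1/M as
   a function of 1/b, are both strictly concave and positive on (0,oo).  The supporting
   lines of such a function have nonnegative coefficients, and Minkowski's inequality
   applied to them gives the comparison of power means of exponent p >= 1; the exponents
   p <= -1 follow by passing to reciprocals. *)
Require Import Defs.
From Stdlib Require Import Reals Ranalysis5 Lra.
From Coquelicot Require Import Coquelicot.
Open Scope R_scope.

(** * Complete elliptic integrals as functions of the parameter [m = r^2] *)

(** With the parameter m = r^2, both K and K' are one function, taken at r^2 and at 1 - r^2, and m =
    0 is an interior point of the domain m < 1. *)
Definition Delta2 (m t : R) : R := 1 - m * sin t ^ 2.

Lemma sin_sqr_bounds (t : R) : 0 <= sin t ^ 2 <= 1.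
Proof.
assert (H := sin2_cos2 t); unfold Rsqr in H.
assert (Hs := pow2_ge_0 (sin t)); assert (Hc := pow2_ge_0 (cos t)); split; nra.
Qed.

Lemma Delta2_pos (m t : R) : m < 1 -> 0 < Delta2 m t.
Proof.
intros Hm; unfold Delta2; destruct (sin_sqr_bounds t) as [H0 H1].
destruct (Rle_dec 0 m); nra.
Qed.

Lemma continuous_comp_Delta2 (h : R -> R) (m t : R) :
  m < 1 -> (forall x, 0 < x -> continuous h x) ->
  continuous (fun t => h (Delta2 m t)) t.
Proof.
intros Hm Hh; apply (continuous_comp (Delta2 m) h).
- apply (ex_derive_continuous (Delta2 m)); unfold Delta2; auto_derive; trivial.
- now apply Hh, Delta2_pos.
Qed.

Lemma ex_RInt_comp_Delta2 (h : R -> R) (m : R) :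
  m < 1 -> (forall x, 0 < x -> continuous h x) ->
  ex_RInt (fun t => h (Delta2 m t)) 0 (PI / 2).
Proof.
intros Hm Hh; apply (ex_RInt_continuous (V := R_CompleteNormedModule)).
intros t _; now apply continuous_comp_Delta2.
Qed.

Lemma locally_lt_1 (m : R) : m < 1 -> locally m (fun u => u < 1).
Proof. exact (open_lt 1 m). Qed.

Lemma is_derive_RInt_Delta2 (h dh : R -> R) (m : R) :
  m < 1 ->
  (forall x, 0 < x -> is_derive h x (dh x)) ->
  (forall x, 0 < x -> continuous dh x) ->
  is_derive (fun m => RInt (fun t => h (Delta2 m t)) 0 (PI / 2)) m
    (RInt (fun t => - sin t ^ 2 * dh (Delta2 m t)) 0 (PI / 2)).
Proof.
intros Hm Hh Hdh.
assert (Hder : forall u t, u < 1 ->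
  is_derive (fun z => h (Delta2 z t)) u (- sin t ^ 2 * dh (Delta2 u t))).
{ intros u t Hu; apply (is_derive_comp h (fun z => Delta2 z t)).
  - now apply Hh, Delta2_pos.
  - unfold Delta2; auto_derive; trivial; ring. }
rewrite <- (RInt_ext (fun t => Derive (fun u => h (Delta2 u t)) m)).
2: { intros t _; now apply is_derive_unique, Hder. }
apply (is_derive_RInt_param (fun u t => h (Delta2 u t))).
- apply (filter_imp (fun u => u < 1)); [|now apply locally_lt_1].
  intros u Hu t _; eexists; now apply Hder.
- intros t _.
  apply (continuity_2d_pt_ext_loc
    (fun u v => - sin v ^ 2 * dh (Delta2 u v))).
  (* Within distance 1 - m of m the parameter stays below 1, so [Hder] applies. *)
  + assert (He : 0 < 1 - m) by lra.
    exists (mkposreal _ He); intros u v Hu _; simpl in Hu.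
    apply Rabs_def2 in Hu.
    symmetry; apply is_derive_unique, Hder; lra.
  + assert (Hs : continuity_2d_pt (fun _ v => sin v ^ 2) m t).
    { apply (continuity_1d_2d_pt_comp (fun x => sin x ^ 2)).
      - apply continuity_pt_filterlim, (ex_derive_continuous (fun x => sin x ^ 2)).
        auto_derive; trivial.
      - apply continuity_2d_pt_id2. }
    apply continuity_2d_pt_mult.
    * now apply continuity_2d_pt_opp.
    * apply (continuity_1d_2d_pt_comp dh).
      -- now apply continuity_pt_filterlim, Hdh, Delta2_pos.
      -- unfold Delta2; apply continuity_2d_pt_minus.
         ++ apply continuity_2d_pt_const.
         ++ apply continuity_2d_pt_mult; [apply continuity_2d_pt_id1|exact Hs].
- apply (filter_imp (fun u => u < 1)); [|now apply locally_lt_1].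
  intros u Hu; apply ex_RInt_comp_Delta2; trivial.
  intros x Hx; apply (ex_derive_continuous h); eexists; now apply Hh.
Qed.

Definition paramK (m : R) : R := RInt (fun t => 1 / sqrt (Delta2 m t)) 0 (PI / 2).
Definition paramE (m : R) : R := RInt (fun t => sqrt (Delta2 m t)) 0 (PI / 2).

Lemma is_derive_inv_sqrt (x : R) :
  0 < x -> is_derive (fun x => 1 / sqrt x) x (- / (2 * sqrt x ^ 3)).
Proof.
intros Hx; assert (Hs := sqrt_lt_R0 x Hx); auto_derive.
- repeat split; trivial; lra.
- field; lra.
Qed.

Lemma is_derive_sqrt_half (x : R) :
  0 < x -> is_derive sqrt x (/ (2 * sqrt x)).
Proof.
intros Hx; assert (Hs := sqrt_lt_R0 x Hx); auto_derive; trivial; field; lra.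
Qed.

Lemma sin_cos_derivative (m t : R) : m < 1 ->
  is_derive (fun t => sin t * cos t / sqrt (Delta2 m t)) t
    ((1 - 2 * sin t ^ 2 + m * sin t ^ 4) / sqrt (Delta2 m t) ^ 3).
Proof.
intros Hm; assert (Hd := Delta2_pos m t Hm).
assert (Hs := sqrt_lt_R0 _ Hd); assert (Hq := sqrt_sqrt _ (Rlt_le _ _ Hd)).
assert (Hc : cos t ^ 2 = 1 - sin t ^ 2)
  by (assert (H := sin2_cos2 t); unfold Rsqr in H; lra).
assert (Hsqrt : is_derive (fun t => sqrt (Delta2 m t)) t
  (- 2 * m * (sin t * cos t) * / (2 * sqrt (Delta2 m t)))).
{ apply (is_derive_comp sqrt (Delta2 m)).
  - now apply is_derive_sqrt_half.
  - unfold Delta2; auto_derive; trivial; ring. }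
assert (Hsc : is_derive (fun t => sin t * cos t) t (cos t ^ 2 - sin t ^ 2))
  by (auto_derive; trivial; ring).
evar_last; [apply (is_derive_div _ _ _ _ _ Hsc Hsqrt); lra|].
set (d := sqrt (Delta2 m t)) in *.
assert (Hd2 : d ^ 2 = 1 - m * sin t ^ 2)
  by (fold (Delta2 m t); rewrite <- Hq; ring).
unfold minus, plus, opp, scal; simpl; unfold mult; simpl.
transitivity ((d ^ 2 * (cos t ^ 2 - sin t ^ 2) + m * (cos t ^ 2 * sin t ^ 2)) / d ^ 3).
- field; lra.
- rewrite Hd2, Hc; field; lra.
Qed.

(** A common integrand for a K + b E: linear relations and inequalities between the integrals become
    pointwise statements about it. *)
Definition elliptic_comb (a b c m t : R) : R :=
  a * (1 / sqrt (Delta2 m t)) + b * sqrt (Delta2 m t)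
  + c * ((1 - 2 * sin t ^ 2 + m * sin t ^ 4) / sqrt (Delta2 m t) ^ 3).

Lemma continuous_elliptic_comb (a b c m t : R) :
  m < 1 -> continuous (elliptic_comb a b c m) t.
Proof.
intros Hm; assert (Hd := Delta2_pos m t Hm); assert (Hs := sqrt_lt_R0 _ Hd).
assert (Hs3 := pow_lt _ 3 Hs).
apply (ex_derive_continuous (elliptic_comb a b c m)).
unfold elliptic_comb, Delta2 in *; auto_derive.
change (1 + - (m * (sin t * (sin t * 1)))) with (1 - m * sin t ^ 2).
repeat split; trivial; simpl in *; lra.
Qed.

(* The coefficient [c] is free because its term is an exact derivative, of a
   function vanishing at both endpoints. *)
Lemma is_RInt_elliptic_comb (a b c m : R) : m < 1 ->
  is_RInt (elliptic_comb a b c m) 0 (PI / 2) (a * paramK m + b * paramE m).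
Proof.
intros Hm.
replace (a * paramK m + b * paramE m)
  with (a * paramK m + b * paramE m + c * 0) by ring.
unfold elliptic_comb.
apply (is_RInt_plus (V := R_NormedModule)
  (fun t => a * (1 / sqrt (Delta2 m t)) + b * sqrt (Delta2 m t)));
  [apply (is_RInt_plus (V := R_NormedModule) (fun t => a * (1 / sqrt (Delta2 m t))))|];
  apply (is_RInt_scal (V := R_NormedModule)).
- apply (RInt_correct (V := R_CompleteNormedModule)).
  apply (ex_RInt_comp_Delta2 (fun x => 1 / sqrt x)); trivial.
  intros x Hx; apply (ex_derive_continuous (fun x => 1 / sqrt x)).
  eexists; now apply is_derive_inv_sqrt.
- apply (RInt_correct (V := R_CompleteNormedModule)).
  apply (ex_RInt_comp_Delta2 sqrt); trivial.
  intros x Hx; apply (ex_derive_continuous sqrt).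
  eexists; now apply is_derive_sqrt_half.
- evar_last.
  + apply (is_RInt_derive (V := R_CompleteNormedModule)
      (fun t => sin t * cos t / sqrt (Delta2 m t))); intros t _.
    * now apply sin_cos_derivative.
    * apply (continuous_ext (elliptic_comb 0 0 1 m)).
      -- intros u; unfold elliptic_comb; rewrite !Rmult_0_l, !Rplus_0_l; apply Rmult_1_l.
      -- now apply continuous_elliptic_comb.
  + unfold minus, plus, opp; simpl.
    rewrite sin_0, cos_PI2; unfold Rdiv; ring.
Qed.

Lemma elliptic_comb_pos (a b c m : R) : m < 1 ->
  (forall t, 0 < t < PI / 2 -> 0 < elliptic_comb a b c m t) ->
  0 < a * paramK m + b * paramE m.
Proof.
intros Hm Hpos.
rewrite <- (is_RInt_unique _ _ _ _ (is_RInt_elliptic_comb a b c m Hm)).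
apply RInt_gt_0; trivial.
- generalize PI_RGT_0; lra.
- intros t _; now apply continuous_elliptic_comb.
Qed.

Lemma sin_sqr_bounds_strict (t : R) : 0 < t < PI / 2 -> 0 < sin t ^ 2 < 1.
Proof.
intros Ht; assert (H := sin2_cos2 t); unfold Rsqr in H.
assert (Hs : 0 < sin t) by (apply sin_gt_0; lra).
assert (Hc : 0 < cos t) by (apply cos_gt_0; lra).
nra.
Qed.

Lemma paramK_pos (m : R) : m < 1 -> 0 < paramK m.
Proof.
intros Hm; replace (paramK m) with (1 * paramK m + 0 * paramE m) by ring.
apply (elliptic_comb_pos _ _ 0); trivial; intros t _.
assert (Hs := sqrt_lt_R0 _ (Delta2_pos m t Hm)).
assert (Hi := Rinv_0_lt_compat _ Hs).
unfold elliptic_comb, Rdiv; lra.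
Qed.

Lemma paramE_pos (m : R) : m < 1 -> 0 < paramE m.
Proof.
intros Hm; replace (paramE m) with (0 * paramK m + 1 * paramE m) by ring.
apply (elliptic_comb_pos _ _ 0); trivial; intros t _.
assert (Hs := sqrt_lt_R0 _ (Delta2_pos m t Hm)).
unfold elliptic_comb, Rdiv; lra.
Qed.

(** The integrand of the difference is m cos^2 t / Delta. *)
Lemma paramE_gt (m : R) : 0 < m < 1 -> (1 - m) * paramK m < paramE m.
Proof.
intros Hm; apply Rlt_0_minus.
replace (paramE m - (1 - m) * paramK m)
  with (- (1 - m) * paramK m + 1 * paramE m) by ring.
apply (elliptic_comb_pos _ _ 0); [lra|]; intros t Ht.
assert (Hd := Delta2_pos m t (proj2 Hm)); assert (Hs := sqrt_lt_R0 _ Hd).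
assert (Hq := sqrt_sqrt _ (Rlt_le _ _ Hd)).
destruct (sin_sqr_bounds_strict t Ht) as [H0 H1].
replace (elliptic_comb _ _ _ _ _)
  with (m * (1 - sin t ^ 2) / sqrt (Delta2 m t)).
- apply Rdiv_lt_0_compat; trivial; nra.
- unfold elliptic_comb; replace (m * (1 - sin t ^ 2))
    with (sqrt (Delta2 m t) * sqrt (Delta2 m t) - (1 - m))
    by (rewrite Hq; unfold Delta2; ring).
  field; lra.
Qed.

(* The weights are chosen so that the integrand becomes [m^2 sin^2 t cos^2 t / Delta^3]. *)
Lemma paramE_lt (m : R) : 0 < m < 1 -> 2 * paramE m < (2 - m) * paramK m.
Proof.
intros Hm; apply Rlt_0_minus.
replace ((2 - m) * paramK m - 2 * paramE m)
  with ((2 - m) * paramK m + (-2) * paramE m) by ring.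
apply (elliptic_comb_pos _ _ m); [lra|]; intros t Ht.
assert (Hd := Delta2_pos m t (proj2 Hm)); assert (Hs := sqrt_lt_R0 _ Hd).
assert (Hq := sqrt_sqrt _ (Rlt_le _ _ Hd)).
destruct (sin_sqr_bounds_strict t Ht) as [H0 H1].
replace (elliptic_comb _ _ _ _ _)
  with (m ^ 2 * (sin t ^ 2 * (1 - sin t ^ 2)) / sqrt (Delta2 m t) ^ 3).
- apply Rdiv_lt_0_compat; [|now apply pow_lt].
  apply Rmult_lt_0_compat; [apply pow_lt; lra|nra].
- transitivity (((2 - m) * sqrt (Delta2 m t) ^ 2 - 2 * (sqrt (Delta2 m t) ^ 2) ^ 2
    + m * (1 - 2 * sin t ^ 2 + m * sin t ^ 4)) / sqrt (Delta2 m t) ^ 3).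
  + rewrite pow2_sqrt; [|lra]; unfold Delta2 at 2 3; field; lra.
  + unfold elliptic_comb; field; lra.
Qed.

(** * Derivatives and continuity in the parameter *)

Lemma is_derive_paramE (m : R) : m < 1 -> m <> 0 ->
  is_derive paramE m ((paramE m - paramK m) / (2 * m)).
Proof.
intros Hm Hm0; evar_last.
- apply (is_derive_RInt_Delta2 sqrt (fun x => / (2 * sqrt x))); trivial.
  + intros x Hx; now apply is_derive_sqrt_half.
  + intros x Hx; assert (Hs := sqrt_lt_R0 x Hx).
    apply (ex_derive_continuous (fun x => / (2 * sqrt x))).
    auto_derive; repeat split; trivial; lra.
- replace ((paramE m - paramK m) / (2 * m))
    with (- / (2 * m) * paramK m + / (2 * m) * paramE m) by (field; trivial).
  rewrite <- (is_RInt_unique _ _ _ _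
    (is_RInt_elliptic_comb (- / (2 * m)) (/ (2 * m)) 0 m Hm)).
  apply RInt_ext; intros t _; unfold elliptic_comb;
    match goal with |- ?x = ?y => change (x = y :> R) end.
  assert (Hd := Delta2_pos m t Hm); assert (Hs := sqrt_lt_R0 _ Hd).
  assert (Hq := sqrt_sqrt _ (Rlt_le _ _ Hd)).
  transitivity ((sqrt (Delta2 m t) * sqrt (Delta2 m t) - 1)
    / (2 * m * sqrt (Delta2 m t))).
  + rewrite Hq; unfold Delta2 at 2; field; lra.
  + field; lra.
Qed.

Lemma is_derive_paramK (m : R) : m < 1 -> m <> 0 ->
  is_derive paramK m ((paramE m - (1 - m) * paramK m) / (2 * m * (1 - m))).
Proof.
intros Hm Hm0; evar_last.
- apply (is_derive_RInt_Delta2 (fun x => 1 / sqrt x)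
    (fun x => - / (2 * sqrt x ^ 3))); trivial.
  + intros x Hx; now apply is_derive_inv_sqrt.
  + intros x Hx; assert (Hs := sqrt_lt_R0 x Hx); assert (Hs3 := pow_lt _ 3 Hs).
    apply (ex_derive_continuous (fun x => - / (2 * sqrt x ^ 3))).
    auto_derive; simpl in Hs3; repeat split; trivial; lra.
- replace ((paramE m - (1 - m) * paramK m) / (2 * m * (1 - m)))
    with (- / (2 * m) * paramK m + / (2 * m * (1 - m)) * paramE m)
    by (field; lra).
  (* Differentiating 1 / Delta gives sin^2 t / (2 Delta^3). The weight - 1 / (2 (1 - m)) on the
     exact derivative absorbs the cubic denominator, leaving only K and E. *)
  rewrite <- (is_RInt_unique _ _ _ _ (is_RInt_elliptic_comb
    (- / (2 * m)) (/ (2 * m * (1 - m))) (- / (2 * (1 - m))) m Hm)).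
  apply RInt_ext; intros t _; unfold elliptic_comb;
    match goal with |- ?x = ?y => change (x = y :> R) end.
  assert (Hd := Delta2_pos m t Hm); assert (Hs := sqrt_lt_R0 _ Hd).
  transitivity (((sqrt (Delta2 m t) ^ 2) ^ 2 - (1 - m) * sqrt (Delta2 m t) ^ 2
    - m * (1 - 2 * sin t ^ 2 + m * sin t ^ 4))
    / (2 * m * (1 - m) * sqrt (Delta2 m t) ^ 3)).
  + rewrite pow2_sqrt; [|lra]; unfold Delta2 at 2 3; field; lra.
  + field; lra.
Qed.

(** Covers m = 0, where the closed form of the derivative divides by zero; this gives continuity of
    [psi_num] at 0 and of [psi_den] at 1. *)
Lemma continuous_paramE (m : R) : m < 1 -> continuous paramE m.
Proof.
intros Hm; apply (ex_derive_continuous paramE); eexists.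
apply (is_derive_RInt_Delta2 sqrt (fun x => / (2 * sqrt x))); trivial.
- intros x Hx; now apply is_derive_sqrt_half.
- intros x Hx; assert (Hs := sqrt_lt_R0 x Hx).
  apply (ex_derive_continuous (fun x => / (2 * sqrt x))).
  auto_derive; repeat split; trivial; lra.
Qed.

Lemma continuous_paramK (m : R) : m < 1 -> continuous paramK m.
Proof.
intros Hm; apply (ex_derive_continuous paramK); eexists.
apply (is_derive_RInt_Delta2 (fun x => 1 / sqrt x)
  (fun x => - / (2 * sqrt x ^ 3))); trivial.
- intros x Hx; now apply is_derive_inv_sqrt.
- intros x Hx; assert (Hs := sqrt_lt_R0 x Hx); assert (Hs3 := pow_lt _ 3 Hs).
  apply (ex_derive_continuous (fun x => - / (2 * sqrt x ^ 3))).
  auto_derive; simpl in Hs3; repeat split; trivial; lra.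
Qed.

Lemma paramE_eq_paramK_0 : paramE 0 = paramK 0.
Proof.
apply RInt_ext; intros t _; unfold Delta2;
  match goal with |- ?x = ?y => change (x = y :> R) end.
rewrite Rmult_0_l, Rminus_0_r, sqrt_1; field.
Qed.

(** * Dependence on the modulus [r] *)

Definition K_ (r : R) : R := paramK (r ^ 2).
Definition E_ (r : R) : R := paramE (r ^ 2).
(** K' and E' written without the square root of [compl_modulus], which keeps differentiation
    polynomial in r. *)
Definition cK (r : R) : R := paramK (1 - r ^ 2).
Definition cE (r : R) : R := paramE (1 - r ^ 2).
Definition psi_num (r : R) : R := E_ r - (1 - r) * K_ r.
Definition psi_den (r : R) : R := cE r - r * cK r.
Definition psi_quot (r : R) : R := 2 * psi_num r / psi_den r.
Definition half_ratio (r : R) : R := cK r / (2 * K_ r).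
(* Equal to [PI / 2] by Legendre's relation, but only its sign matters here. *)
Definition legendre (r : R) : R := E_ r * cK r + cE r * K_ r - K_ r * cK r.

Lemma sqr_bounds (r : R) : 0 < r < 1 -> 0 < r ^ 2 < 1.
Proof. nra. Qed.

Lemma K_pos (r : R) : 0 < r < 1 -> 0 < K_ r.
Proof. intros Hr; now apply paramK_pos, sqr_bounds. Qed.

Lemma cK_pos (r : R) : 0 < r < 1 -> 0 < cK r.
Proof. intros Hr; apply paramK_pos; destruct (sqr_bounds r Hr); lra. Qed.

Lemma E_pos (r : R) : 0 < r < 1 -> 0 < E_ r.
Proof. intros Hr; now apply paramE_pos, sqr_bounds. Qed.

Lemma E_gt (r : R) : 0 < r < 1 -> (1 - r ^ 2) * K_ r < E_ r.
Proof. intros Hr; now apply paramE_gt, sqr_bounds. Qed.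

Lemma E_lt (r : R) : 0 < r < 1 -> 2 * E_ r < (2 - r ^ 2) * K_ r.
Proof. intros Hr; now apply paramE_lt, sqr_bounds. Qed.

Lemma cE_gt (r : R) : 0 < r < 1 -> r ^ 2 * cK r < cE r.
Proof.
intros Hr; replace (r ^ 2) with (1 - (1 - r ^ 2)) at 1 by ring.
apply paramE_gt; destruct (sqr_bounds r Hr); lra.
Qed.

Lemma cE_lt (r : R) : 0 < r < 1 -> 2 * cE r < (1 + r ^ 2) * cK r.
Proof.
intros Hr; replace (1 + r ^ 2) with (2 - (1 - r ^ 2)) by ring.
apply paramE_lt; destruct (sqr_bounds r Hr); lra.
Qed.

(** E > (1 - r^2) K and E' > r^2 K' give E K' + E' K > K K', since the two coefficients add up to
    1. *)
Lemma legendre_pos (r : R) : 0 < r < 1 -> 0 < legendre r.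
Proof.
intros Hr; assert (HK := K_pos r Hr); assert (HK' := cK_pos r Hr).
assert (H1 := Rmult_lt_compat_r _ _ _ HK' (E_gt r Hr)).
assert (H2 := Rmult_lt_compat_r _ _ _ HK (cE_gt r Hr)).
unfold legendre; lra.
Qed.

Lemma is_derive_comp_sqr (f : R -> R) (df r : R) :
  is_derive f (r ^ 2) df -> is_derive (fun r => f (r ^ 2)) r (2 * r * df).
Proof.
intros Hf; apply (is_derive_comp f (fun r => r ^ 2)); trivial.
auto_derive; trivial; ring.
Qed.

Lemma is_derive_comp_cosqr (f : R -> R) (df r : R) :
  is_derive f (1 - r ^ 2) df -> is_derive (fun r => f (1 - r ^ 2)) r (- 2 * r * df).
Proof.
intros Hf; apply (is_derive_comp f (fun r => 1 - r ^ 2)); trivial.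
auto_derive; trivial; ring.
Qed.

Lemma is_derive_K (r : R) : 0 < r < 1 ->
  is_derive K_ r ((E_ r - (1 - r ^ 2) * K_ r) / (r * (1 - r ^ 2))).
Proof.
intros Hr; destruct (sqr_bounds r Hr) as [H0 H1]; evar_last.
- apply (is_derive_comp_sqr paramK), is_derive_paramK; lra.
- fold (E_ r) (K_ r); field; lra.
Qed.

Lemma is_derive_E (r : R) : 0 < r < 1 ->
  is_derive E_ r ((E_ r - K_ r) / r).
Proof.
intros Hr; destruct (sqr_bounds r Hr) as [H0 H1]; evar_last.
- apply (is_derive_comp_sqr paramE), is_derive_paramE; lra.
- fold (E_ r) (K_ r); field; lra.
Qed.

Lemma is_derive_cK (r : R) : 0 < r < 1 ->
  is_derive cK r (- (cE r - r ^ 2 * cK r) / (r * (1 - r ^ 2))).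
Proof.
intros Hr; destruct (sqr_bounds r Hr) as [H0 H1]; evar_last.
- apply (is_derive_comp_cosqr paramK), is_derive_paramK; lra.
- fold (cE r) (cK r); field; lra.
Qed.

Lemma is_derive_cE (r : R) : 0 < r < 1 ->
  is_derive cE r (- r * (cE r - cK r) / (1 - r ^ 2)).
Proof.
intros Hr; destruct (sqr_bounds r Hr) as [H0 H1]; evar_last.
- apply (is_derive_comp_cosqr paramE), is_derive_paramE; lra.
- fold (cE r) (cK r); field; lra.
Qed.

(** All terms in K cancel, so the sign of the derivative is evident. *)
Lemma is_derive_psi_num (r : R) : 0 < r < 1 ->
  is_derive psi_num r (E_ r / (1 + r)).
Proof.
intros Hr; destruct (sqr_bounds r Hr) as [H0 H1].
assert (Hid : is_derive (fun r => 1 - r) r (-1)) by (auto_derive; trivial; ring).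
evar_last.
- apply (is_derive_minus (V := R_NormedModule) E_ (fun r => (1 - r) * K_ r)).
  + now apply is_derive_E.
  + apply (is_derive_mult (fun r => 1 - r) K_); [exact Hid|now apply is_derive_K|].
    intros; apply Rmult_comm.
- unfold minus, plus, opp, mult; simpl; field; nra.
Qed.

Lemma is_derive_psi_den (r : R) : 0 < r < 1 ->
  is_derive psi_den r ((cE r - cK r) / (1 + r)).
Proof.
intros Hr; destruct (sqr_bounds r Hr) as [H0 H1]; evar_last.
- apply (is_derive_minus (V := R_NormedModule) cE (fun r => r * cK r)).
  + now apply is_derive_cE.
  + apply (is_derive_mult (fun r => r) cK);
      [apply (is_derive_id r)|now apply is_derive_cK|].
    intros; apply Rmult_comm.
- unfold minus, plus, opp, mult, one; simpl; field; nra.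
Qed.

(** Derivatives are asked for only in the open interval, so that [psi_num] can be compared with its
    value at 0 and [psi_den] with its value at 1. *)
Lemma derive_pos_lt (f df : R -> R) (a b : R) : a < b ->
  (forall x, a <= x <= b -> continuous f x) ->
  (forall x, a < x < b -> is_derive f x (df x)) ->
  (forall x, a < x < b -> 0 < df x) ->
  f a < f b.
Proof.
intros Hab Hc Hd Hpos.
(* [MVT_gen] may return an endpoint, where nothing is known about [df]. *)
pose (df' x := if Rlt_dec a x then if Rlt_dec x b then df x else 1 else 1).
destruct (MVT_gen f a b df') as [c [_ Hmvt]].
- rewrite Rmin_left, Rmax_right by lra; intros x Hx; unfold df'.
  destruct (Rlt_dec a x); [|lra]; destruct (Rlt_dec x b); [|lra]; now apply Hd.
- rewrite Rmin_left, Rmax_right by lra; intros x Hx.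
  now apply continuity_pt_filterlim, Hc.
- assert (0 < df' c).
  { unfold df'; destruct (Rlt_dec a c); [destruct (Rlt_dec c b)|]; try lra.
    apply Hpos; lra. }
  nra.
Qed.

(** * Monotonicity of numerator and denominator, and surjectivity of psi *)

Lemma continuous_psi_num (r : R) : -1 < r < 1 -> continuous psi_num r.
Proof.
intros Hr; assert (Hr2 : r ^ 2 < 1) by nra.
assert (Hsq : continuous (fun r => r ^ 2) r)
  by (apply (ex_derive_continuous (fun r => r ^ 2)); auto_derive; trivial).
apply (continuous_minus (V := R_NormedModule) E_ (fun r => (1 - r) * K_ r)).
- apply (continuous_comp (fun r => r ^ 2) paramE); trivial.
  now apply continuous_paramE.
- apply (continuous_mult (fun r => 1 - r) K_).
  + apply (ex_derive_continuous (fun r => 1 - r)); auto_derive; trivial.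
  + apply (continuous_comp (fun r => r ^ 2) paramK); trivial.
    now apply continuous_paramK.
Qed.

Lemma continuous_psi_den (r : R) : 0 < r -> continuous psi_den r.
Proof.
intros Hr; assert (Hr2 : 1 - r ^ 2 < 1) by nra.
assert (Hsq : continuous (fun r => 1 - r ^ 2) r)
  by (apply (ex_derive_continuous (fun r => 1 - r ^ 2)); auto_derive; trivial).
apply (continuous_minus (V := R_NormedModule) cE (fun r => r * cK r)).
- apply (continuous_comp (fun r => 1 - r ^ 2) paramE); trivial.
  now apply continuous_paramE.
- apply (continuous_mult (fun r => r) cK).
  + apply continuous_id.
  + apply (continuous_comp (fun r => 1 - r ^ 2) paramK); trivial.
    now apply continuous_paramK.
Qed.

Lemma psi_num_0 : psi_num 0 = 0.
Proof.
unfold psi_num, E_, K_; replace (0 ^ 2) with 0 by ring.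
rewrite paramE_eq_paramK_0; ring.
Qed.

Lemma psi_den_1 : psi_den 1 = 0.
Proof.
unfold psi_den, cE, cK; replace (1 - 1 ^ 2) with 0 by ring.
rewrite paramE_eq_paramK_0; ring.
Qed.

Lemma psi_num_incr (r s : R) : 0 <= r < s -> s < 1 -> psi_num r < psi_num s.
Proof.
intros Hr Hs; apply (derive_pos_lt _ (fun r => E_ r / (1 + r))); [lra|..].
- intros x Hx; apply continuous_psi_num; lra.
- intros x Hx; apply is_derive_psi_num; lra.
- intros x Hx; apply Rdiv_lt_0_compat; [apply E_pos|]; lra.
Qed.

Lemma psi_den_decr (r s : R) : 0 < r < s -> s <= 1 -> psi_den s < psi_den r.
Proof.
intros Hr Hs; apply Ropp_lt_cancel.
apply (derive_pos_lt (fun r => - psi_den r) (fun r => - ((cE r - cK r) / (1 + r))));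
  [lra|..].
- intros x Hx; apply (continuous_opp psi_den), continuous_psi_den; lra.
- intros x Hx; apply (is_derive_opp psi_den), is_derive_psi_den; lra.
- intros x Hx; replace (- ((cE x - cK x) / (1 + x)))
    with ((cK x - cE x) / (1 + x)) by (field; lra).
  assert (Hx' : 0 < x < 1) by lra.
  assert (H := cE_lt x Hx'); assert (H' := cK_pos x Hx').
  (* Added to [H], this yields E' < K'. *)
  assert (H'' : 0 < (1 - x ^ 2) * cK x) by (apply Rmult_lt_0_compat; nra).
  apply Rdiv_lt_0_compat; lra.
Qed.

Lemma psi_num_pos (r : R) : 0 < r < 1 -> 0 < psi_num r.
Proof. intros Hr; rewrite <- psi_num_0; apply psi_num_incr; lra. Qed.

Lemma psi_den_pos (r : R) : 0 < r < 1 -> 0 < psi_den r.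
Proof. intros Hr; rewrite <- psi_den_1; apply psi_den_decr; lra. Qed.

(** The intermediate value theorem is applied to 2 [psi_num] - y [psi_den]. Near 0 the numerator is
    small and near 1 the denominator is; monotonicity compares the other term with its value at 1/2,
    so no limit at a divergent endpoint is taken. *)
Lemma psi_quot_surj (y : R) : 0 < y -> exists r, 0 < r < 1 /\ psi_quot r = y.
Proof.
intros Hy; assert (Hhalf : 0 < / 2 < 1) by lra.
assert (HA := psi_num_pos _ Hhalf); assert (HB := psi_den_pos _ Hhalf).
assert (He0 : 0 < y * psi_den (/ 2) / 2)
  by (apply Rdiv_lt_0_compat; [apply Rmult_lt_0_compat|]; lra).
assert (He1 : 0 < 2 * psi_num (/ 2) / y) by (apply Rdiv_lt_0_compat; lra).
assert (Hc0 : continuous psi_num 0) by (apply continuous_psi_num; lra).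
assert (Hc1 : continuous psi_den 1) by (apply continuous_psi_den; lra).
destruct (Hc0 (fun z => z < y * psi_den (/ 2) / 2)) as [[d0 Hd0] Hn].
{ rewrite psi_num_0; exact (open_lt _ _ He0). }
destruct (Hc1 (fun z => z < 2 * psi_num (/ 2) / y)) as [[d1 Hd1] Hd].
{ rewrite psi_den_1; exact (open_lt _ _ He1). }
simpl in Hn, Hd.
(* The minimum puts [l] both inside the neighbourhood of 0 given by continuity and below 1/2; [u] =
   1 - [v] is treated likewise at 1. *)
assert (Hl : exists l, 0 < l < / 2 /\ 2 * psi_num l < y * psi_den (/ 2)).
{ pose (l := Rmin (d0 / 2) (/ 4)).
  assert (Hl : 0 < l <= / 4)
    by (unfold l; split; [apply Rmin_glb_lt; lra|apply Rmin_r]).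
  assert (Hld : l <= d0 / 2) by apply Rmin_l.
  exists l; split; [lra|].
  assert (psi_num l < y * psi_den (/ 2) / 2); [|lra].
  apply Hn; change (Rabs (l - 0) < d0); rewrite Rabs_pos_eq; lra. }
assert (Hu : exists u, / 2 < u < 1 /\ y * psi_den u < 2 * psi_num (/ 2)).
{ pose (v := Rmin (d1 / 2) (/ 4)).
  assert (Hv : 0 < v <= / 4)
    by (unfold v; split; [apply Rmin_glb_lt; lra|apply Rmin_r]).
  assert (Hvd : v <= d1 / 2) by apply Rmin_l.
  exists (1 - v); split; [lra|].
  assert (Hlt : psi_den (1 - v) < 2 * psi_num (/ 2) / y).
  { apply Hd; change (Rabs (1 - v - 1) < d1).
    replace (1 - v - 1) with (- v) by ring.
    rewrite Rabs_Ropp, Rabs_pos_eq; lra. }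
  apply (Rmult_lt_compat_l _ _ _ Hy) in Hlt.
  replace (y * (2 * psi_num (/ 2) / y)) with (2 * psi_num (/ 2)) in Hlt
    by (field; lra).
  exact Hlt. }
destruct Hl as [l [Hl Hlt]], Hu as [u [Hu Hut]].
assert (Hdl := psi_den_decr l (/ 2)); assert (Hnu := psi_num_incr (/ 2) u).
destruct (IVT_interv (fun r => 2 * psi_num r - y * psi_den r) l u) as [r [Hr Hr0]].
- intros x Hx; apply continuity_pt_minus; apply continuity_pt_scal;
    apply continuity_pt_filterlim;
    [apply continuous_psi_num|apply continuous_psi_den]; lra.
- lra.
- assert (y * psi_den (/ 2) < y * psi_den l)
    by (apply Rmult_lt_compat_l; trivial; apply Hdl; lra).
  lra.
- assert (psi_num (/ 2) < psi_num u) by (apply Hnu; lra); lra.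
- assert (Hr1 : 0 < r < 1) by lra; exists r; split; trivial.
  assert (Hp := psi_den_pos r Hr1); unfold psi_quot.
  replace (2 * psi_num r) with (y * psi_den r) by lra.
  field; lra.
Qed.

(** * The modulus of the curve family in terms of r *)

Lemma compl_modulus_sqr (r : R) : 0 < r < 1 -> compl_modulus r ^ 2 = 1 - r ^ 2.
Proof. intros Hr; apply pow2_sqrt; nra. Qed.

Lemma ellK'_eq (r : R) : 0 < r < 1 -> ellK' r = cK r.
Proof. intros Hr; unfold cK; now rewrite <- compl_modulus_sqr. Qed.

Lemma ellE'_eq (r : R) : 0 < r < 1 -> ellE' r = cE r.
Proof. intros Hr; unfold cE; now rewrite <- compl_modulus_sqr. Qed.

Lemma psi_eq (r : R) : 0 < r < 1 -> psi r = psi_quot r.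
Proof. intros Hr; unfold psi; now rewrite ellE'_eq, ellK'_eq. Qed.

Lemma psi_inv_spec (y : R) : 0 < y ->
  0 < psi_inv y < 1 /\ psi_quot (psi_inv y) = y.
Proof.
intros Hy; assert (Hs : 0 < psi_inv y < 1 /\ psi (psi_inv y) = y).
{ apply (ClassicalEpsilon.epsilon_spec (inhabits 0)
    (fun r => 0 < r < 1 /\ psi r = y)).
  destruct (psi_quot_surj y Hy) as [r [Hr Hry]]; exists r.
  now rewrite psi_eq. }
destruct Hs as [Hr Hp]; now rewrite <- psi_eq.
Qed.

Lemma modulus_Gamma_eq (b : R) : 0 < b ->
  modulus_Gamma b = half_ratio (psi_inv (1 / b)).
Proof.
intros Hb; destruct (psi_inv_spec (1 / b)) as [Hr _].
{ apply Rdiv_lt_0_compat; lra. }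
unfold modulus_Gamma, mu, half_ratio; rewrite ellK'_eq; trivial.
change (ellK (psi_inv (1 / b))) with (K_ (psi_inv (1 / b))).
assert (HK := K_pos _ Hr); generalize PI_RGT_0; intros HPI; field; lra.
Qed.

Lemma is_derive_psi_quot (r : R) : 0 < r < 1 ->
  is_derive psi_quot r
    (2 * (1 - r) * legendre r / ((1 + r) * psi_den r ^ 2)).
Proof.
intros Hr; assert (Hd := psi_den_pos r Hr); evar_last.
- apply (is_derive_div (fun r => 2 * psi_num r) psi_den); [| |lra].
  + now apply (is_derive_scal psi_num), is_derive_psi_num.
  + now apply is_derive_psi_den.
(* The bracket of the quotient rule equals (1 - r) times the Legendre combination. *)
- transitivity (2 * (E_ r * psi_den r - psi_num r * (cE r - cK r))
    / ((1 + r) * psi_den r ^ 2)).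
  + unfold minus, plus, opp, scal, mult; simpl; field; lra.
  + f_equal; unfold psi_den, psi_num, legendre; ring.
Qed.

Lemma is_derive_inv_psi_quot (r : R) : 0 < r < 1 ->
  is_derive (fun r => / psi_quot r) r
    (- ((1 - r) * legendre r / (2 * (1 + r) * psi_num r ^ 2))).
Proof.
intros Hr; assert (Hd := psi_den_pos r Hr); assert (Hn := psi_num_pos r Hr).
evar_last.
- apply is_derive_inv; [now apply is_derive_psi_quot|].
  apply Rgt_not_eq, Rdiv_lt_0_compat; lra.
- unfold psi_quot; field; lra.
Qed.

Lemma is_derive_half_ratio (r : R) : 0 < r < 1 ->
  is_derive half_ratio r (- (legendre r / (2 * (r * (1 - r ^ 2)) * K_ r ^ 2))).
Proof.
intros Hr; assert (HK := K_pos r Hr); assert (Hr2 := sqr_bounds r Hr); evar_last.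
- apply (is_derive_div cK (fun r => 2 * K_ r)); [| |lra].
  + now apply is_derive_cK.
  + now apply (is_derive_scal K_), is_derive_K.
- unfold minus, plus, opp, scal, mult, legendre; simpl.
  field; nra.
Qed.

Lemma is_derive_inv_half_ratio (r : R) : 0 < r < 1 ->
  is_derive (fun r => / half_ratio r) r
    (2 * legendre r / (r * (1 - r ^ 2) * cK r ^ 2)).
Proof.
intros Hr; assert (HK := K_pos r Hr); assert (HK' := cK_pos r Hr).
assert (Hr2 := sqr_bounds r Hr); evar_last.
- apply is_derive_inv; [now apply is_derive_half_ratio|].
  apply Rgt_not_eq, Rdiv_lt_0_compat; lra.
- unfold half_ratio; field; lra.
Qed.

(** * The two slopes and their monotonicity *)

Definition num_ratio (r : R) : R := psi_num r / K_ r.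
Definition den_ratio (r : R) : R := psi_den r / cK r.

(** Eliminating E / K in favour of c = [num_ratio] leaves a Riccati equation, so later sign
    questions involve only c and r. The same holds for [den_ratio]. *)
Lemma is_derive_num_ratio (r : R) : 0 < r < 1 ->
  is_derive num_ratio r ((num_ratio r + 1 - r) / (1 + r)
    - num_ratio r * (num_ratio r - r * (1 - r)) / (r * (1 - r) * (1 + r))).
Proof.
intros Hr; assert (HK := K_pos r Hr); assert (Hr2 := sqr_bounds r Hr); evar_last.
- apply (is_derive_div psi_num K_); [| |lra].
  + now apply is_derive_psi_num.
  + now apply is_derive_K.
- unfold minus, plus, opp, scal, mult, num_ratio, psi_num; simpl.
  field; nra.
Qed.

Lemma is_derive_den_ratio (r : R) : 0 < r < 1 ->
  is_derive den_ratio r ((den_ratio r - 1 + r) / (1 + r)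
    + den_ratio r * (den_ratio r + r * (1 - r)) / (r * (1 - r) * (1 + r))).
Proof.
intros Hr; assert (HK := cK_pos r Hr); assert (Hr2 := sqr_bounds r Hr); evar_last.
- apply (is_derive_div psi_den cK); [| |lra].
  + now apply is_derive_psi_den.
  + now apply is_derive_cK.
- unfold minus, plus, opp, scal, mult, den_ratio, psi_den; simpl.
  field; nra.
Qed.

(** The upper bound comes from [E_lt], which even gives c < r - r^2 / 2. It is the sign of the
    factor 2 r - c in the derivative of the slope. *)
Lemma num_ratio_bounds (r : R) : 0 < r < 1 -> 0 < num_ratio r < 2 * r.
Proof.
intros Hr; assert (HK := K_pos r Hr); assert (HE := E_lt r Hr); unfold num_ratio.
split.
- apply Rdiv_lt_0_compat; trivial; now apply psi_num_pos.
- apply Rlt_div_l; trivial; unfold psi_num; nra.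
Qed.

(** The upper bound is exactly [cE_lt] divided by K', because (1 + r^2) / 2 - r = (1 - r)^2 / 2. *)
Lemma den_ratio_bounds (r : R) : 0 < r < 1 -> 0 < den_ratio r < (1 - r) ^ 2 / 2.
Proof.
intros Hr; assert (HK := cK_pos r Hr); assert (HE := cE_lt r Hr); unfold den_ratio.
split.
- apply Rdiv_lt_0_compat; trivial; now apply psi_den_pos.
- apply Rlt_div_l; trivial; unfold psi_den; lra.
Qed.

(** At [num_ratio] this is dM/db, at [den_ratio] it is d(1/M)/d(1/b). *)
Definition slope (c : R -> R) (r : R) : R := c r ^ 2 / (r * (1 - r) ^ 2).

Lemma is_derive_slope (c dc : R -> R) (r : R) : 0 < r < 1 ->
  is_derive c r (dc r) ->
  is_derive (slope c) r
    (c r * (2 * r * (1 - r) * dc r - (1 - 3 * r) * c r) / (r ^ 2 * (1 - r) ^ 3)).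
Proof.
intros Hr Hc; evar_last.
- apply (is_derive_div (fun r => c r ^ 2) (fun r => r * (1 - r) ^ 2)).
  + apply (is_derive_pow c 2 r), Hc.
  + auto_derive; [trivial|reflexivity].
  + apply Rgt_not_eq, Rmult_lt_0_compat; [lra|apply pow_lt; lra].
- simpl; field; lra.
Qed.

Lemma slope_num_incr (r s : R) : 0 < r < s -> s < 1 ->
  slope num_ratio r < slope num_ratio s.
Proof.
intros Hr Hs; assert (Hd : forall x, 0 < x < 1 -> is_derive (slope num_ratio) x
  (num_ratio x * (2 * x - num_ratio x) * (2 * num_ratio x + (1 - x) ^ 2)
    / (x ^ 2 * (1 - x) ^ 3 * (1 + x)))).
{ intros x Hx; evar_last.
  (* Only the derivative at this one point matters, so a constant function stands in for [dc]. *)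
  - now eapply (is_derive_slope _ (fun _ => _)), is_derive_num_ratio.
  - simpl; field; lra. }
eapply derive_pos_lt; [lra|..].
- intros x Hx; apply (ex_derive_continuous (slope num_ratio)); eexists; apply Hd; lra.
- intros x Hx; apply Hd; lra.
- intros x Hx; destruct (num_ratio_bounds x) as [H0 H1]; [lra|].
  apply Rdiv_lt_0_compat.
  + assert (Hp : 0 < (1 - x) ^ 2) by (apply pow_lt; lra).
    apply Rmult_lt_0_compat; [apply Rmult_lt_0_compat|]; lra.
  + repeat apply Rmult_lt_0_compat; try apply pow_lt; lra.
Qed.

Lemma slope_den_decr (r s : R) : 0 < r < s -> s < 1 ->
  slope den_ratio s < slope den_ratio r.
Proof.
intros Hr Hs; assert (Hd : forall x, 0 < x < 1 ->
  is_derive (fun x => - slope den_ratio x) x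
    (den_ratio x * ((1 - x) ^ 2 - 2 * den_ratio x) * (den_ratio x + 2 * x)
      / (x ^ 2 * (1 - x) ^ 3 * (1 + x)))).
{ intros x Hx; evar_last.
  - apply (is_derive_opp (slope den_ratio)).
    now eapply (is_derive_slope _ (fun _ => _)), is_derive_den_ratio.
  - unfold opp; simpl; field; lra. }
apply Ropp_lt_cancel.
eapply (derive_pos_lt (fun x => - slope den_ratio x)); [lra|..].
- intros x Hx; apply (ex_derive_continuous (fun x => - slope den_ratio x)).
  eexists; apply Hd; lra.
- intros x Hx; apply Hd; lra.
- intros x Hx; destruct (den_ratio_bounds x) as [H0 H1]; [lra|].
  apply Rdiv_lt_0_compat.
  + apply Rmult_lt_0_compat; [apply Rmult_lt_0_compat|]; lra.
  + repeat apply Rmult_lt_0_compat; try apply pow_lt; lra.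
Qed.

(** Concavity of a parametrized curve with slope D = dY/dX. The sign condition covers X increasing
    with D decreasing and the reverse. It makes Y - D(r) X increase before r and decrease after it,
    so r is its strict maximum. *)
Lemma parametric_tangent (X Y D dX : R -> R) :
  (forall r, 0 < r < 1 -> is_derive X r (dX r)) ->
  (forall r, 0 < r < 1 -> is_derive Y r (D r * dX r)) ->
  (forall r s, 0 < r < s -> s < 1 ->
     0 < (D r - D s) * dX r /\ 0 < (D r - D s) * dX s) ->
  forall r s, 0 < r < 1 -> 0 < s < 1 -> s <> r ->
  Y s < Y r + D r * (X s - X r).
Proof.
intros HX HY HD r s Hr Hs Hsr.
assert (Hphi : forall x, 0 < x < 1 ->
  is_derive (fun x => Y x - D r * X x) x ((D x - D r) * dX x)).
{ intros x Hx; evar_last.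
  - apply (is_derive_minus (V := R_NormedModule) Y (fun x => D r * X x)).
    + now apply HY.
    + now apply (is_derive_scal X), HX.
  - unfold minus, plus, opp; simpl; ring. }
enough (Y s - D r * X s < Y r - D r * X r) by lra.
assert (Hc : forall x, 0 < x < 1 -> continuous (fun x => Y x - D r * X x) x).
{ intros x Hx; apply (ex_derive_continuous (fun x => Y x - D r * X x)).
  eexists; now apply Hphi. }
destruct (Rtotal_order s r) as [Hlt|[Heq|Hgt]]; [|easy|].
- apply (derive_pos_lt (fun x => Y x - D r * X x) (fun x => (D x - D r) * dX x));
    trivial; intros x Hx; [apply Hc|apply Hphi|apply HD]; lra.
- apply Ropp_lt_cancel.
  apply (derive_pos_lt (fun x => - (Y x - D r * X x))
    (fun x => - ((D x - D r) * dX x))); trivial; intros x Hx.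
  + apply (continuous_opp (fun x => Y x - D r * X x)), Hc; lra.
  + apply (is_derive_opp (fun x => Y x - D r * X x)), Hphi; lra.
  + destruct (HD r x) as [_ H]; lra.
Qed.

(** Here X is b = 1 / psi, which decreases in r while the slope increases; in [inv_modulus_tangent]
    X is psi, and both directions are reversed. *)
Lemma modulus_tangent (r s : R) : 0 < r < 1 -> 0 < s < 1 -> s <> r ->
  half_ratio s < half_ratio r + slope num_ratio r * (/ psi_quot s - / psi_quot r).
Proof.
revert r s; apply (parametric_tangent (fun r => / psi_quot r) half_ratio
  (slope num_ratio) (fun r => - ((1 - r) * legendre r / (2 * (1 + r) * psi_num r ^ 2)))).
- exact is_derive_inv_psi_quot.
- intros r Hr; evar_last; [now apply is_derive_half_ratio|].
  assert (Hn := psi_num_pos r Hr); assert (HK := K_pos r Hr).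
  assert (Hr2 := sqr_bounds r Hr).
  unfold slope, num_ratio; field; nra.
- assert (Hneg : forall r, 0 < r < 1 ->
    0 < (1 - r) * legendre r / (2 * (1 + r) * psi_num r ^ 2)).
  { intros r Hr; apply Rdiv_lt_0_compat.
    - apply Rmult_lt_0_compat; [lra|now apply legendre_pos].
    - apply Rmult_lt_0_compat; [lra|apply pow_lt; now apply psi_num_pos]. }
  intros r s Hr Hs; assert (Hrs := slope_num_incr r s Hr Hs).
  rewrite !Ropp_mult_distr_r_reverse, !Ropp_mult_distr_l.
  split; apply Rmult_lt_0_compat; try lra; apply Hneg; lra.
Qed.

Lemma inv_modulus_tangent (r s : R) : 0 < r < 1 -> 0 < s < 1 -> s <> r ->
  / half_ratio s < / half_ratio r + slope den_ratio r * (psi_quot s - psi_quot r).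
Proof.
revert r s; apply (parametric_tangent psi_quot (fun r => / half_ratio r)
  (slope den_ratio) (fun r => 2 * (1 - r) * legendre r / ((1 + r) * psi_den r ^ 2))).
- exact is_derive_psi_quot.
- intros r Hr; evar_last; [now apply is_derive_inv_half_ratio|].
  assert (Hn := psi_den_pos r Hr); assert (HK := cK_pos r Hr).
  assert (Hr2 := sqr_bounds r Hr).
  unfold slope, den_ratio; field; nra.
- assert (Hpos : forall r, 0 < r < 1 ->
    0 < 2 * (1 - r) * legendre r / ((1 + r) * psi_den r ^ 2)).
  { intros r Hr; apply Rdiv_lt_0_compat.
    - apply Rmult_lt_0_compat; [lra|now apply legendre_pos].
    - apply Rmult_lt_0_compat; [lra|apply pow_lt; now apply psi_den_pos]. }
  intros r s Hr Hs; assert (Hrs := slope_den_decr r s Hr Hs).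
  split; apply Rmult_lt_0_compat; try lra; apply Hpos; lra.
Qed.

(** * Positive strictly concave functions and power means *)

(** Strict concavity is phrased by supporting lines, the form in which the tangent lemmas deliver
    it. *)
Definition pos_strictly_concave (f : R -> R) : Prop :=
  (forall x, 0 < x -> 0 < f x) /\
  (forall c, 0 < c ->
     exists m, forall x, 0 < x -> x <> c -> f x < f c + m * (x - c)).

(* A negative coefficient would make the supporting line, hence [f], negative
   somewhere on the half-line. *)
Lemma supporting_line (f : R -> R) (c : R) : pos_strictly_concave f -> 0 < c ->
  exists m k, 0 <= m /\ 0 <= k /\ f c = m * c + k /\
    forall x, 0 < x -> x <> c -> f x < m * x + k.
Proof.
intros [Hpos Hsup] Hc; destruct (Hsup c Hc) as [m Hm].
assert (Hfc := Hpos c Hc); exists m, (f c - m * c).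
assert (Hm0 : 0 <= m).
(* The zero of the supporting line, to the right of c. *)
{ apply Rnot_lt_le; intros Hneg; pose (x := c + f c / - m).
  assert (Hd : 0 < f c / - m) by (apply Rdiv_lt_0_compat; lra).
  assert (Hx : m * (x - c) = - f c) by (unfold x; field; lra).
  assert (Hx0 : 0 < x) by (unfold x; lra).
  assert (Hxc : x <> c) by (unfold x; lra).
  generalize (Hpos x Hx0) (Hm x Hx0 Hxc); lra. }
repeat split; trivial; [|ring|].
- apply Rnot_lt_le; intros Hneg.
  assert (Hm1 : 0 < m) by nra.
  (* Again the zero of the line; it lies at - k / m, positive because the intercept k is assumed
     negative. *)
  pose (x := c - f c / m).
  assert (Hd : 0 < f c / m) by (apply Rdiv_lt_0_compat; lra).
  assert (Hx : m * (x - c) = - f c) by (unfold x; field; lra).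
  assert (Hx0 : 0 < x) by nra.
  assert (Hxc : x <> c) by (unfold x; lra).
  generalize (Hpos x Hx0) (Hm x Hx0 Hxc); lra.
- intros x Hx Hxc; generalize (Hm x Hx Hxc); lra.
Qed.

Lemma pos_strictly_concave_incr (f : R -> R) (a b : R) :
  pos_strictly_concave f -> 0 < a < b -> f a < f b.
Proof.
intros Hf Hab; destruct (supporting_line f b Hf) as (m & k & Hm & _ & Hb & H); [lra|].
assert (Ha : f a < m * a + k) by (apply H; lra).
nra.
Qed.

Lemma pos_strictly_concave_inj (f : R -> R) (a b : R) :
  pos_strictly_concave f -> 0 < a -> 0 < b -> a <> b -> f a <> f b.
Proof.
intros Hf Ha Hb Hab; destruct (Rtotal_order a b) as [H|[H|H]]; [|easy|].
- apply Rlt_not_eq, pos_strictly_concave_incr; trivial; lra.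
- apply Rgt_not_eq, pos_strictly_concave_incr; trivial; lra.
Qed.

(** Add the supporting line at the midpoint over a and b: the slope terms cancel. *)
Lemma pos_strictly_concave_midpoint (f : R -> R) (a b : R) :
  pos_strictly_concave f -> 0 < a -> 0 < b -> a <> b ->
  (f a + f b) / 2 < f ((a + b) / 2).
Proof.
intros [_ Hf] Ha Hb Hab; destruct (Hf ((a + b) / 2)) as [m Hm]; [lra|].
assert (H1 := Hm a Ha); assert (H2 := Hm b Hb); lra.
Qed.

(** Write v^q = v exp((q - 1) ln v) >= v (1 + (q - 1) ln v) and use v ln v >= v - 1; both bounds are
    instances of exp x >= 1 + x. *)
Lemma Rpower_bernoulli (v q : R) : 0 < v -> 1 <= q -> 1 + q * (v - 1) <= Rpower v q.
Proof.
intros Hv Hq; unfold Rpower; set (c := ln v).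
assert (Hvc : v = exp c) by (symmetry; now apply exp_ln).
assert (H1 := exp_ineq1_le ((q - 1) * c)); assert (H2 := exp_ineq1_le (- c)).
replace (q * c) with (c + (q - 1) * c) by ring.
rewrite exp_plus; rewrite exp_Ropp in H2; rewrite <- Hvc in *.
apply (Rmult_le_compat_l v) in H1; [|lra].
apply (Rmult_le_compat_l v) in H2; [|lra].
rewrite Rinv_r in H2 by lra.
apply (Rmult_le_compat_l (q - 1)) in H2; [|lra].
lra.
Qed.

(** Rescaled, Bernoulli's inequality is the tangent bound at z = l w + (1 - l). Averaging it over w
    and 1 with weights l and 1 - l removes the linear term. *)
Lemma Rpower_convex (l w q : R) : 0 <= l <= 1 -> 0 < w -> 1 <= q ->
  Rpower (l * w + (1 - l)) q <= l * Rpower w q + (1 - l).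
Proof.
intros Hl Hw Hq; set (z := l * w + (1 - l)).
assert (Hz : 0 < z) by (unfold z; destruct (Req_dec l 0); [subst; lra|nra]).
assert (Hpz : 0 < Rpower z q) by apply exp_pos.
assert (Htan : forall y, 0 < y ->
  Rpower z q * (1 + q * (y / z - 1)) <= Rpower y q).
{ intros y Hy; replace (Rpower y q) with (Rpower z q * Rpower (y / z) q).
  - apply Rmult_le_compat_l; [lra|].
    apply Rpower_bernoulli; trivial; now apply Rdiv_lt_0_compat.
  - rewrite Rpower_mult_distr; trivial; [f_equal; field; lra|].
    now apply Rdiv_lt_0_compat. }
assert (H1 := Htan 1 Rlt_0_1); assert (Hw' := Htan w Hw).
replace (Rpower 1 q) with 1 in H1
  by (unfold Rpower; rewrite ln_1, Rmult_0_r, exp_0; reflexivity).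
apply (Rmult_le_compat_l l) in Hw'; [|lra].
apply (Rmult_le_compat_l (1 - l)) in H1; [|lra].
replace (Rpower z q) with (l * (Rpower z q * (1 + q * (w / z - 1)))
  + (1 - l) * (Rpower z q * (1 + q * (1 / z - 1)))); [lra|].
transitivity (Rpower z q * (1 + q * ((l * w + (1 - l)) / z - 1))).
- field; lra.
- fold z; field; lra.
Qed.

(** Divided by f(c), the supporting line at c is the convex combination l (x/c) + (1 - l) with l = m
    c / f(c). Convexity of the power then gives a bound affine in x^q, ready to be averaged. *)
Lemma concave_power_bound (f : R -> R) (q c : R) :
  pos_strictly_concave f -> 1 <= q -> 0 < c ->
  exists l, forall x, 0 < x ->
    let bound := Rpower (f c) q * (l * (Rpower x q / Rpower c q) + (1 - l)) in
    Rpower (f x) q <= bound /\ (x <> c -> Rpower (f x) q < bound).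
Proof.
intros Hf Hq Hc; destruct (supporting_line f c Hf Hc) as (m & k & Hm & Hk & Hfc & Hsup).
assert (HT := proj1 Hf c Hc); pose (l := m * c / f c); exists l.
assert (Hl : 0 <= l <= 1).
{ unfold l; split; [apply Rdiv_le_0_compat; nra|].
  apply Rle_div_l; trivial; nra. }
intros x Hx bound; assert (Hfx := proj1 Hf x Hx).
assert (Hxc : 0 < x / c) by now apply Rdiv_lt_0_compat.
assert (Hline : m * x + k = f c * (l * (x / c) + (1 - l))).
{ replace k with (f c - m * c) by lra; unfold l; field; lra. }
assert (Hz : 0 < l * (x / c) + (1 - l)) by (destruct (Req_dec l 0) as [->|]; nra).
assert (Hb : Rpower (m * x + k) q <= bound).
{ rewrite Hline, <- Rpower_mult_distr; trivial; unfold bound.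
  apply Rmult_le_compat_l; [apply Rlt_le, exp_pos|].
  replace (Rpower x q / Rpower c q) with (Rpower (x / c) q).
  - now apply Rpower_convex.
  - unfold Rdiv; rewrite <- Rpower_mult_distr; trivial.
    + f_equal; unfold Rpower; rewrite ln_Rinv, <- exp_Ropp; trivial; f_equal; ring.
    + now apply Rinv_0_lt_compat. }
assert (Hlt : x <> c -> Rpower (f x) q < bound).
{ intros Hne; apply Rlt_le_trans with (2 := Hb).
  apply Rlt_Rpower_l; [lra|]; split; auto. }
split; trivial; destruct (Req_dec x c) as [->|Hne]; [|now apply Rlt_le, Hlt].
rewrite Hfc at 1; exact Hb.
Qed.

Lemma power_mean_pos (p x y : R) : p <> 0 -> 0 < power_mean p x y.
Proof.
intros Hp; unfold power_mean; destruct (Req_EM_T p 0); [easy|apply exp_pos].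
Qed.

Lemma Rpower_power_mean (p x y : R) : p <> 0 ->
  Rpower (power_mean p x y) p = (Rpower x p + Rpower y p) / 2.
Proof.
intros Hp; unfold power_mean; destruct (Req_EM_T p 0); [easy|].
rewrite Rpower_mult; replace (1 / p * p) with 1 by (field; trivial).
apply Rpower_1; assert (H := exp_pos (p * ln x)); assert (H' := exp_pos (p * ln y)).
unfold Rpower; lra.
Qed.

Lemma power_mean_diag (p x : R) : p <> 0 -> 0 < x -> power_mean p x x = x.
Proof.
intros Hp Hx; unfold power_mean; destruct (Req_EM_T p 0); [easy|].
replace ((Rpower x p + Rpower x p) / 2) with (Rpower x p) by field.
rewrite Rpower_mult; replace (p * (1 / p)) with 1 by (field; trivial).
now apply Rpower_1.
Qed.

(** Carries exponents p <= -1 over to exponents at least 1. *)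
Lemma power_mean_inv (p x y : R) : p <> 0 -> 0 < x -> 0 < y ->
  power_mean p x y = / power_mean (- p) (/ x) (/ y).
Proof.
intros Hp Hx Hy; unfold power_mean.
destruct (Req_EM_T p 0); [easy|]; destruct (Req_EM_T (- p) 0); [lra|].
assert (Hi : forall z, 0 < z -> Rpower (/ z) (- p) = Rpower z p).
{ intros z Hz; unfold Rpower; rewrite ln_Rinv; trivial; f_equal; ring. }
rewrite !Hi, <- Rpower_Ropp; trivial; f_equal; field; lra.
Qed.

(** At c = [power_mean q a b] the ratios a^q / c^q and b^q / c^q average to 1, so the affine bounds
    for a and b average to f(c)^q. *)
Lemma power_mean_lt_concave (f : R -> R) (q a b : R) :
  pos_strictly_concave f -> 1 <= q -> 0 < a -> 0 < b -> a <> b ->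
  power_mean q (f a) (f b) < f (power_mean q a b).
Proof.
intros Hf Hq Ha Hb Hab; assert (Hq0 : q <> 0) by lra.
set (c := power_mean q a b); assert (Hc : 0 < c) by now apply power_mean_pos.
assert (HT := proj1 Hf c Hc).
assert (Hpc : Rpower c q = (Rpower a q + Rpower b q) / 2) by now apply Rpower_power_mean.
destruct (concave_power_bound f q c Hf Hq Hc) as [l Hl].
destruct (Hl a Ha) as [Hla Hsa], (Hl b Hb) as [Hlb Hsb].
assert (Hpc0 : 0 < Rpower c q) by apply exp_pos.
assert (Hsum : (Rpower (f a) q + Rpower (f b) q) / 2 < Rpower (f c) q).
{ replace (Rpower (f c) q) with
    ((Rpower (f c) q * (l * (Rpower a q / Rpower c q) + (1 - l))
      + Rpower (f c) q * (l * (Rpower b q / Rpower c q) + (1 - l))) / 2).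
  (* Since a and b differ, at least one of them differs from c and supplies strictness. *)
  - destruct (Req_dec a c) as [Hac|Hac].
    + assert (Hbc : b <> c) by congruence; specialize (Hsb Hbc); lra.
    + specialize (Hsa Hac); lra.
  - transitivity (Rpower (f c) q *
      (l * ((Rpower a q + Rpower b q) / 2 / Rpower c q) + (1 - l))).
    + field; lra.
    + rewrite <- Hpc; field; lra. }
rewrite <- (Rpower_power_mean q (f a) (f b) Hq0) in Hsum.
apply Rnot_le_lt; intros Hle.
assert (Rpower (f c) q <= Rpower (power_mean q (f a) (f b)) q)
  by (apply Rle_Rpower_l; lra).
lra.
Qed.

Lemma sqrt_mult_lt_half_sum (u v : R) : 0 < u -> 0 < v -> u <> v ->
  sqrt (u * v) < (u + v) / 2.
Proof.
intros Hu Hv Huv; apply Rnot_le_lt; intros Hle.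
assert (Hg := sqrt_sqrt (u * v)); assert (Hsq : 0 < (u - v) ^ 2).
{ apply pow2_gt_0; lra. }
assert (0 <= u * v) by nra; specialize (Hg H); nra.
Qed.

Lemma le_and_eq_iff (a b x y : R) :
  (a = b -> x = y) -> (a <> b -> x < y) -> x <= y /\ (x = y <-> a = b).
Proof.
intros Heq Hlt; destruct (Req_dec a b) as [Hab|Hab].
- rewrite (Heq Hab); intuition lra.
- specialize (Hlt Hab); intuition lra.
Qed.

(** * The modulus *)

Lemma modulus_pos (b : R) : 0 < b -> 0 < modulus_Gamma b.
Proof.
intros Hb; rewrite modulus_Gamma_eq; trivial.
destruct (psi_inv_spec (1 / b)) as [Hr _]; [apply Rdiv_lt_0_compat; lra|].
assert (HK := K_pos _ Hr); apply Rdiv_lt_0_compat; [now apply cK_pos|lra].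
Qed.

Lemma modulus_concave : pos_strictly_concave modulus_Gamma.
Proof.
split; [exact modulus_pos|]; intros c Hc.
exists (slope num_ratio (psi_inv (1 / c))); intros x Hx Hxc.
rewrite !modulus_Gamma_eq; trivial.
destruct (psi_inv_spec (1 / c)) as [Hr Hpr]; [apply Rdiv_lt_0_compat; lra|].
destruct (psi_inv_spec (1 / x)) as [Hs Hps]; [apply Rdiv_lt_0_compat; lra|].
replace (x - c) with (/ psi_quot (psi_inv (1 / x)) - / psi_quot (psi_inv (1 / c)))
  by (rewrite Hpr, Hps; field; lra).
apply modulus_tangent; trivial; intros Heq; apply Hxc.
rewrite Heq, Hpr in Hps; apply Rinv_eq_reg; unfold Rdiv in Hps; lra.
Qed.

Lemma inv_modulus_concave : pos_strictly_concave (fun x => / modulus_Gamma (/ x)).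
Proof.
assert (Heq : forall x, 0 < x -> modulus_Gamma (/ x) = half_ratio (psi_inv x)).
{ intros x Hx; rewrite modulus_Gamma_eq by now apply Rinv_0_lt_compat.
  do 2 f_equal; field; lra. }
split.
- intros x Hx; now apply Rinv_0_lt_compat, modulus_pos, Rinv_0_lt_compat.
- intros c Hc; exists (slope den_ratio (psi_inv c)); intros x Hx Hxc.
  rewrite !Heq; trivial.
  destruct (psi_inv_spec c Hc) as [Hr Hpr], (psi_inv_spec x Hx) as [Hs Hps].
  replace (x - c) with (psi_quot (psi_inv x) - psi_quot (psi_inv c)) by lra.
  apply inv_modulus_tangent; trivial; congruence.
Qed.

(** Midpoint concavity of x -> 1 / M(1/x) at 1/a and 1/b puts the left side below the harmonic mean
    of M(a) and M(b), which lies below their geometric mean. *)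
Lemma modulus_harmonic_lt (a b : R) : 0 < a -> 0 < b -> a <> b ->
  modulus_Gamma (2 * a * b / (a + b)) < sqrt (modulus_Gamma a * modulus_Gamma b).
Proof.
intros Ha Hb Hab; assert (Hia := Rinv_0_lt_compat a Ha).
assert (Hib := Rinv_0_lt_compat b Hb).
assert (Hne : / a <> / b) by (intros H; now apply Hab, Rinv_eq_reg).
assert (H := pos_strictly_concave_midpoint _ _ _ inv_modulus_concave Hia Hib Hne).
simpl in H; rewrite !Rinv_inv in H.
replace (/ ((/ a + / b) / 2)) with (2 * a * b / (a + b)) in H by (field; lra).
assert (Hu := modulus_pos a Ha); assert (Hv := modulus_pos b Hb).
assert (Hw : 0 < modulus_Gamma (2 * a * b / (a + b))).
{ apply modulus_pos, Rdiv_lt_0_compat; nra. }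
assert (Hamgm := sqrt_mult_lt_half_sum _ _ Hu Hv
  (pos_strictly_concave_inj _ _ _ modulus_concave Ha Hb Hab)).
set (u := modulus_Gamma a) in *; set (v := modulus_Gamma b) in *.
set (w := modulus_Gamma _) in *; set (g := sqrt (u * v)) in *.
assert (Hg : 0 < g) by (apply sqrt_lt_R0; nra).
assert (Hgg : g * g = u * v) by (apply sqrt_sqrt; nra).
apply Rinv_lt_cancel; trivial; apply Rlt_trans with (2 := H).
(* Over the common denominator g^2 = u v the claim becomes g < (u + v) / 2. *)
replace ((/ u + / v) / 2) with ((u + v) / 2 / (g * g)) by (rewrite Hgg; field; lra).
replace (/ g) with (g / (g * g)) by (field; lra).
apply Rmult_lt_compat_r; trivial; apply Rinv_0_lt_compat; nra.
Qed.

Theorem theorem4p7 :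
  forall a b : R, 0 < a -> 0 < b ->
  (* (1) *)
  ((modulus_Gamma (2 * a * b / (a + b))
      <= sqrt (modulus_Gamma a * modulus_Gamma b) /\
    (modulus_Gamma (2 * a * b / (a + b))
      = sqrt (modulus_Gamma a * modulus_Gamma b) <-> a = b)) /\
   (sqrt (modulus_Gamma a * modulus_Gamma b)
      <= (modulus_Gamma a + modulus_Gamma b) / 2 /\
    (sqrt (modulus_Gamma a * modulus_Gamma b)
      = (modulus_Gamma a + modulus_Gamma b) / 2 <-> a = b)) /\
   ((modulus_Gamma a + modulus_Gamma b) / 2
      <= modulus_Gamma ((a + b) / 2) /\
    ((modulus_Gamma a + modulus_Gamma b) / 2
      = modulus_Gamma ((a + b) / 2) <-> a = b))) /\
  (* (2) *)
  (forall p : R,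
    (p <= -1 ->
      modulus_Gamma (power_mean p a b)
        <= power_mean p (modulus_Gamma a) (modulus_Gamma b) /\
      (modulus_Gamma (power_mean p a b)
        = power_mean p (modulus_Gamma a) (modulus_Gamma b) <-> a = b)) /\
    (1 <= p ->
      modulus_Gamma (power_mean p a b)
        >= power_mean p (modulus_Gamma a) (modulus_Gamma b) /\
      (modulus_Gamma (power_mean p a b)
        = power_mean p (modulus_Gamma a) (modulus_Gamma b) <-> a = b))).
Proof.
intros a b Ha Hb.
assert (Hu := modulus_pos a Ha); assert (Hv := modulus_pos b Hb).
split; [split; [|split]|intros p; split; intros Hp].
- apply le_and_eq_iff.
  + intros <-; rewrite sqrt_square by lra; f_equal; field; lra.
  + now apply modulus_harmonic_lt.
- apply le_and_eq_iff.
  + intros <-; rewrite sqrt_square by lra; field.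
  + intros Hab; apply sqrt_mult_lt_half_sum; trivial.
    now apply (pos_strictly_concave_inj _ _ _ modulus_concave).
- apply le_and_eq_iff.
  + intros <-; replace ((a + a) / 2) with a by field; field.
  + now apply (pos_strictly_concave_midpoint _ _ _ modulus_concave).
- assert (Hp0 : p <> 0) by lra; apply le_and_eq_iff.
  + intros <-; now rewrite !power_mean_diag.
  + intros Hab; rewrite !(power_mean_inv p) by trivial.
    assert (Hne : / a <> / b) by (intros H; now apply Hab, Rinv_eq_reg).
    assert (H : power_mean (- p) (/ modulus_Gamma a) (/ modulus_Gamma b)
      < / modulus_Gamma (/ power_mean (- p) (/ a) (/ b))).
    (* Double inverses exhibit the arguments of the mean as values of x -> 1 / M(1/x) at 1/a and
       1/b. *)
    { rewrite <- (Rinv_inv a) at 1; rewrite <- (Rinv_inv b) at 1.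
      apply (power_mean_lt_concave _ (- p) (/ a) (/ b) inv_modulus_concave);
        trivial; try lra; now apply Rinv_0_lt_compat. }
    apply Rinv_lt_cancel.
    * apply Rinv_0_lt_compat, power_mean_pos; lra.
    * now rewrite Rinv_inv.
- assert (Hp0 : p <> 0) by lra.
  destruct (le_and_eq_iff a b (power_mean p (modulus_Gamma a) (modulus_Gamma b))
    (modulus_Gamma (power_mean p a b))) as [Hle Hiff].
  + intros <-; now rewrite !power_mean_diag.
  + now apply (power_mean_lt_concave _ _ _ _ modulus_concave).
  + split; [now apply Rle_ge|]; rewrite <- Hiff; split; congruence.
Qed.
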